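(* Let $R \cong R_1\times\cdots\times R_r$ ($r\ge 1$) with finite commutative local rings $R_i$. Then the number of vertices of the compressed zero-divisor graph $\Gamma_E(R)$ equals $$\# V(\Gamma_E(R)) = \prod_{i=1}^r\big(\# V(\Gamma_E(R_i)) + 2\big) - 2 = \prod_{i=1}^r \#(R_i)_E - 2 .$$
   Context: Rings are finite and commutative with $1\neq 0$. For $r\in R$ let $[r]_R=\{s\in R \mid \mathrm{ann}_R(r)=\mathrm{ann}_R(s)\}$, and let $R_E=\{[r]_R \mid r\in R\}$. One has $[0]_R=\{0\}$, and $[1]_R$ is the set of units of $R$. The compressed zero-divisor graph $\Gamma_E(R)$ has vertex set $R_E\setminus\{[0]_R,[1]_R\}$ (the classes of non-zero zero-divisors), with $[x]_R,[y]_R$ adjacent iff $xy=0$. $\#S$ is the cardinality of a set $S$. *)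

(* Defs.v *)
From HB Require Import structures.
From mathcomp Require Import all_boot all_order all_algebra.

Set Implicit Arguments.
Unset Strict Implicit.
Unset Printing Implicit Defensive.

Import GRing.Theory.
Local Open Scope ring_scope.

(* The library has the ring structure on non-dependent finite functions only.
   The instances stop at comPzRingType because the empty product is the zero
   ring. *)
Definition ring_prod (I : finType) (S : I -> comPzRingType) : Type :=
  {dffun forall i, S i}.

Section RingProd.
Variables (I : finType) (S : I -> comPzRingType).
Implicit Types f g h : ring_prod S.

HB.instance Definition _ := Choice.copy (ring_prod S) {dffun forall i, S i}.

Definition rp_zero : ring_prod S := [ffun i => 0 : S i].
Definition rp_one : ring_prod S := [ffun i => 1 : S i].
Definition rp_opp f : ring_prod S := [ffun i => - f i : S i].
Definition rp_add f g : ring_prod S := [ffun i => f i + g i : S i].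
Definition rp_mul f g : ring_prod S := [ffun i => f i * g i : S i].

Fact rp_addA : associative rp_add.
Proof. by move=> f g h; apply/ffunP=> i; rewrite !ffunE addrA. Qed.
Fact rp_addC : commutative rp_add.
Proof. by move=> f g; apply/ffunP=> i; rewrite !ffunE addrC. Qed.
Fact rp_add0 : left_id rp_zero rp_add.
Proof. by move=> f; apply/ffunP=> i; rewrite !ffunE add0r. Qed.
Fact rp_addN : left_inverse rp_zero rp_opp rp_add.
Proof. by move=> f; apply/ffunP=> i; rewrite !ffunE addNr. Qed.

HB.instance Definition _ := GRing.isZmodule.Build (ring_prod S)
  rp_addA rp_addC rp_add0 rp_addN.

Fact rp_mulA : associative rp_mul.
Proof. by move=> f g h; apply/ffunP=> i; rewrite !ffunE mulrA. Qed.
Fact rp_mulC : commutative rp_mul.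
Proof. by move=> f g; apply/ffunP=> i; rewrite !ffunE mulrC. Qed.
Fact rp_mul1 : left_id rp_one rp_mul.
Proof. by move=> f; apply/ffunP=> i; rewrite !ffunE mul1r. Qed.
Fact rp_mulD : left_distributive rp_mul rp_add.
Proof. by move=> f g h; apply/ffunP=> i; rewrite !ffunE mulrDl. Qed.

HB.instance Definition _ := GRing.Zmodule_isComPzRing.Build (ring_prod S)
  rp_mulA rp_mulC rp_mul1 rp_mulD.

End RingProd.

Definition ring_isomorphic (A B : pzRingType) : Prop :=
  exists phi : {rmorphism A -> B}, bijective phi.

(* [idealr_closed] includes properness (1 \notin M). *)
Definition maximal_ideal (R : finComNzRingType) (M : {set R}) : Prop :=
  idealr_closed M /\
  forall J : {set R}, idealr_closed J -> M \subset J -> J = M.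

Definition local_ring (R : finComNzRingType) : Prop :=
  exists! M : {set R}, maximal_ideal M.

Record fgraph (T : finType) := FGraph { vertices : {set T}; adj : rel T }.

Section CompressedZeroDivisorGraph.
Variable R : finComNzRingType.

Definition ann (r : R) : {set R} := [set s | r * s == 0].

Definition ann_class (r : R) : {set R} := [set s | ann r == ann s].

Definition ann_classes : {set {set R}} := [set ann_class r | r : R].

Definition czd_vertices : {set {set R}} :=
  ann_classes :\: [set ann_class 0; ann_class 1].

(* Independent of the representatives: see [czd_adjE]. *)
Definition czd_adj : rel {set R} := fun X Y =>
  [&& X \in czd_vertices, Y \in czd_vertices &
      [exists x in X, exists y in Y, x * y == 0]].

Definition czd_graph : fgraph {set R} := FGraph czd_vertices czd_adj.

Lemma ann_class_id r : r \in ann_class r.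
Proof. by rewrite inE. Qed.

Lemma czd_adjE x y :
    ann_class x \in czd_vertices -> ann_class y \in czd_vertices ->
  czd_adj (ann_class x) (ann_class y) = (x * y == 0).
Proof.
move=> Vx Vy; rewrite /czd_adj Vx Vy /=; apply/exists_inP/idP; last first.
  move=> xy0; exists x; first exact: ann_class_id.
  by apply/exists_inP; exists y; rewrite ?ann_class_id.
case=> x1; rewrite inE => /eqP ex /exists_inP[y1]; rewrite inE => /eqP ey xy0.
have: y1 \in ann x by rewrite ex inE.
rewrite inE mulrC => yx0; have: x \in ann y by rewrite ey inE.
by rewrite inE mulrC.
Qed.

End CompressedZeroDivisorGraph.

(* Main.v *)
Require Import Defs.
From mathcomp Require Import all_boot all_order all_algebra.

Set Implicit Arguments.
Unset Strict Implicit.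
Unset Printing Implicit Defensive.

(** An element of a product ring annihilates another exactly when it does so in
every coordinate, so annihilator classes of the product are tuples of
annihilator classes of the factors; and in a nonzero ring exactly two of the
classes, those of [0] and [1], are not vertices. *)

Import GRing.Theory.
Local Open Scope ring_scope.

(** Both images are projections of the image of the pairing [x |-> (f x, g x)]; as [f] and [g] have
    the same fibres, each projection is injective there. *)
Lemma card_imset_same_kernel (T : finType) (U V : finType)
    (f : T -> U) (g : T -> V) :
  (forall x y, f x = f y <-> g x = g y) ->
  #|[set f x | x : T]| = #|[set g x | x : T]|.
Proof.
move=> fg; pose fg_pair x := (f x, g x).
transitivity #|[set fg_pair x | x : T]|.
  have -> : [set f x | x : T] = fst @: [set fg_pair x | x : T].
    by rewrite -imset_comp.
  apply: card_in_imset => _ _ /imsetP[x _ ->] /imsetP[y _ ->] /= fxy.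
  by rewrite /fg_pair fxy (proj1 (fg _ _) fxy).
have -> : [set g x | x : T] = snd @: [set fg_pair x | x : T].
  by rewrite -imset_comp.
symmetry; apply: card_in_imset => _ _ /imsetP[x _ ->] /imsetP[y _ ->] /= gxy.
by rewrite /fg_pair gxy (proj2 (fg _ _) gxy).
Qed.

Section AnnClasses.
Variable R : finComNzRingType.
Implicit Types x y : R.

Lemma eq_ann_class x y : (ann_class x = ann_class y) <-> (ann x = ann y).
Proof.
split=> [exy|exy]; last by apply/setP=> s; rewrite !inE exy.
by apply/eqP; have := ann_class_id y; rewrite -exy inE.
Qed.

Lemma eq_annP x y : (ann x = ann y) <-> (forall s, x * s = 0 <-> y * s = 0).
Proof.
split=> [exy s|exy]; last first.
  by apply/setP=> s; rewrite !inE; apply/eqP/eqP => /exy.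
by have /setP/(_ s) := exy; rewrite !inE => e; split=> /eqP h; apply/eqP;
  rewrite ?e // -e.
Qed.

Lemma ann_class0_neq1 : ann_class (0 : R) != ann_class 1.
Proof.
(* Tested on [1], which annihilates [0], equal annihilators would force [1 * 1 = 0]. *)
apply/eqP=> /eq_ann_class/eq_annP/(_ 1)[/(_ (mul0r _))/eqP].
by rewrite mulr1 oner_eq0.
Qed.

Lemma card_ann_classes : #|ann_classes R| = (#|czd_vertices R| + 2)%N.
Proof.
have sub : [set ann_class (0 : R); ann_class 1] \subset ann_classes R.
  by apply/subsetP=> _ /set2P[]->; apply: imset_f.
(* The two removed classes are distinct and lie in [ann_classes R], so the subtraction of 2 in [nat]
   does not truncate. *)
rewrite /czd_vertices cardsD (setIidPr sub) cards2 ann_class0_neq1 subnK //.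
by have := subset_leq_card sub; rewrite cards2 ann_class0_neq1.
Qed.

End AnnClasses.

Section Product.
Variables (R : finComNzRingType) (I : finType) (S : I -> finComNzRingType).
Variable phi : {rmorphism R -> ring_prod (fun i => S i)}.
Hypothesis phi_bij : bijective phi.

Lemma eq_ann_prod (x y : R) :
  (ann x = ann y) <-> (forall i, ann (phi x i) = ann (phi y i)).
Proof.
have [psi phiK psiK] := phi_bij.
have mul0P z s : (z * s = 0) <-> (forall i, phi z i * phi s i = 0).
  split=> [zs0 i|zs0].
    by have /ffunP/(_ i) := rmorphM phi z s; rewrite zs0 rmorph0 !ffunE.
  apply: (can_inj phiK); rewrite rmorphM rmorph0.
  by apply/ffunP=> i; rewrite !ffunE zs0.
split=> [/eq_annP exy i|exy].
  apply/eq_annP=> a.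
  (* The element with [a] in coordinate [i] and 0 elsewhere: it tests annihilation in that
     coordinate alone. *)
  pose s := psi [ffun j => dfwith (fun j => 0 : S j) a j].
  have mulsP z : (z * s = 0) <-> (phi z i * a = 0).
    split=> [/mul0P/(_ i)|za0]; first by rewrite psiK ffunE dfwith_in.
    apply/mul0P=> j; rewrite psiK ffunE.
    by case: dfwithP => // k _; rewrite mulr0.
  by split=> /mulsP/exy/mulsP.
have exy_i i := proj1 (eq_annP _ _) (exy i).
by apply/eq_annP=> s; split=> /mul0P h; apply/mul0P=> i; apply/exy_i/h.
Qed.

(** The map [F] to tuples of coordinate classes has the same fibres as [ann_class], by
    [eq_ann_prod], and its image is the whole product of the sets of classes. *)
Lemma card_ann_classes_prod :
  #|ann_classes R| = (\prod_i #|ann_classes (S i)|)%N.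
Proof.
pose F x := [ffun i => ann_class (phi x i)] : {dffun forall i, {set S i}}.
rewrite -cardsXn.
have -> : setXn (fun i => ann_classes (S i)) = [set F x | x : R].
  apply/setP=> G; apply/setXnP/imsetP=> [GS|[x _ ->] i]; last first.
    by rewrite ffunE imset_f.
  have [psi _ psiK] := phi_bij.
  (* A representative of the class [G i]; the default 0 is never taken, since [GS] makes every [G i]
     a class. *)
  pose rep i := odflt 0 [pick a | G i == ann_class a].
  exists (psi [ffun i => rep i]) => //.
  apply/ffunP=> i; rewrite ffunE psiK ffunE /rep.
  case: pickP => [a /eqP //|no]; have /imsetP[a _ Ga] := GS i.
  by have := no a; rewrite Ga eqxx.
apply: card_imset_same_kernel => x y.
split=> [/eq_ann_class/eq_ann_prod exy|/ffunP exy].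
  by apply/ffunP=> i; rewrite !ffunE; apply/eq_ann_class.
apply/eq_ann_class/eq_ann_prod => i.
by have := exy i; rewrite !ffunE => /eq_ann_class.
Qed.

End Product.

Theorem theorem3p2 (R : finComNzRingType) (r : nat)
    (S : 'I_r -> finComNzRingType) (hr : (1 <= r)%N)
    (hlocal : forall i : 'I_r, local_ring (S i))
    (hR : ring_isomorphic R (ring_prod (fun i : 'I_r => S i))) :
  #|vertices (czd_graph R)|%:Z
    = \prod_(i < r) (#|vertices (czd_graph (S i))|%:Z + 2) - 2
  /\
  \prod_(i < r) (#|vertices (czd_graph (S i))|%:Z + 2) - 2
    = \prod_(i < r) #|ann_classes (S i)|%:Z - 2.
Proof.
have cardE (Q : finComNzRingType) :
    #|vertices (czd_graph Q)|%:Z + 2 = #|ann_classes Q|%:Z.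
  by rewrite card_ann_classes.
have [phi phi_bij] := hR.
under eq_bigr => i _ do rewrite cardE.
(* With the factors rewritten, the second equation is trivial; moving the 2 across turns the first
   into the class count of [R], cast to the integers. *)
split=> //; apply/eqP; rewrite eq_sym subr_eq cardE.
rewrite (card_ann_classes_prod phi_bij) -natz natr_prod.
by apply/eqP/eq_bigr => i _; rewrite natz.
Qed.
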